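(* There exists an absolute constant $c>0$ such that the following holds. Let $p,q$ be arbitrary probability distributions on a finite set $\mathcal X$ and let $0\le\varepsilon_0\le d_{\mathrm{TV}}(p,q)/4$. Then for all $\varepsilon$ satisfying $0\le\varepsilon-\varepsilon_0\le c\,\varepsilon_0^2$, the sample complexities at $\varepsilon$ and $\varepsilon_0$ are comparable: $$n^*_{\mathrm{TV}}(\varepsilon_0)\asymp n^*_{\mathrm{TV}}(\varepsilon),\qquad n^*_{\mathrm{Hub}}(\varepsilon_0)\asymp n^*_{\mathrm{Hub}}(\varepsilon),\qquad n^*_{\mathrm{Sub}}(\varepsilon_0)\asymp n^*_{\mathrm{Sub}}(\varepsilon).$$
   Context: $\Delta(\mathcal X)$ is the set of probability distributions on $\mathcal X$; $d_{\mathrm{TV}}(p,q)=\frac12\sum_x|p(x)-q(x)|$. The uncertainty sets are $\mathcal P_{\mathrm{Hub}}(p,\varepsilon)=\{(1-\varepsilon)p+\varepsilon h: h\in\Delta(\mathcal X)\}$, $\mathcal P_{\mathrm{TV}}(p,\varepsilon)=\{p'\in\Delta(\mathcal X): d_{\mathrm{TV}}(p',p)\le\varepsilon\}$, $\mathcal P_{\mathrm{Sub}}(p,\varepsilon)=\{p'\in\Delta(\mathcal X): p'(x)\le(1+\varepsilon)p(x)\ \forall x\}$. For $A\in\{\mathrm{Hub},\mathrm{TV},\mathrm{Sub}\}$, $n^*_A(\varepsilon)$ is the smallest $n$ for which there is a (possibly randomised) test $\phi:\mathcal X^n\to\{0,1\}$ with $\sup_{P\in\mathcal P_A(p,\varepsilon)}\mathbb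 P_{P^{\otimes n}}(\phi=1)+\sup_{Q\in\mathcal P_A(q,\varepsilon)}\mathbb P_{Q^{\otimes n}}(\phi=0)\le\frac1{10}$ ($\infty$ if there is none). $f\asymp g$ means $a\,g\le f\le b\,g$ with universal constants $a,b>0$ (independent of $p,q,\varepsilon,\varepsilon_0$). *)

(* Defs.v *)
From HB Require Import structures.
From mathcomp Require Import all_boot all_order all_algebra.
From mathcomp Require Import all_classical all_reals ereal.
Set Implicit Arguments.
Unset Strict Implicit.
Unset Printing Implicit Defensive.
Import Order.TTheory GRing.Theory Num.Theory.
Local Open Scope classical_set_scope.
Local Open Scope ring_scope.

Definition distributions (R : realType) (X : finType) : set (X -> R) :=
  [set p | (forall x, 0 <= p x) /\ \sum_x p x = 1].
Arguments distributions : clear implicits.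

Definition dTV (R : realType) (X : finType) (p q : X -> R) : R :=
  2^-1 * \sum_x `|p x - q x|.

Inductive contamination := Hub | TV | Sub.

Definition uncertainty (R : realType) (X : finType) (A : contamination)
    (p : X -> R) (eps : R) : set (X -> R) :=
  match A with
  | Hub => [set (fun x => (1 - eps) * p x + eps * h x)
             | h in distributions R X]
  | TV => [set p' | distributions R X p' /\ dTV p' p <= eps]
  | Sub => [set p' | distributions R X p' /\
             forall x, p' x <= (1 + eps) * p x]
  end.

(* A randomised test on n samples: the distribution of the output bit in
   {0, 1} = {false, true} given the sample. *)
Definition rtest (R : realType) (X : finType) (n : nat) :=
  {ffun 'I_n -> X} -> bool -> R.

Definition is_rtest (R : realType) (X : finType) (n : nat)
    (phi : rtest R X n) : Prop :=
  forall s, distributions R bool (phi s).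

(* The probability that phi outputs b on n i.i.d. samples from P. *)
Definition prob_output (R : realType) (X : finType) (n : nat) (P : X -> R)
    (phi : rtest R X n) (b : bool) : R :=
  \sum_(s : {ffun 'I_n -> X}) (\prod_(i < n) P (s i)) * phi s b.

Definition worst_error (R : realType) (X : finType) (n : nat)
    (U : set (X -> R)) (phi : rtest R X n) (b : bool) : \bar R :=
  ereal_sup [set (prob_output P phi b)%:E | P in U].

Definition testable (R : realType) (X : finType) (A : contamination)
    (p q : X -> R) (eps : R) (n : nat) : Prop :=
  exists2 phi : rtest R X n, is_rtest phi &
    (worst_error (uncertainty A p eps) phi true
     + worst_error (uncertainty A q eps) phi false <= (10^-1)%:E)%E.

(* The infimum of a set of naturals is its least element, and it is +oo on
   the empty set. *)
Definition sample_complexity (R : realType) (X : finType) (A : contamination)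
    (p q : X -> R) (eps : R) : \bar R :=
  ereal_inf [set (n%:R)%:E | n in [set n | testable A p q eps n]].

(* Main.v *)
(* Every uncertainty set shrinks towards its centre: for l = eps0 / eps, the map
   P |-> (1 - l) p + l P sends the set of radius eps into the set of radius eps0
   and moves P by at most eps - eps0 in total variation.  A test on n samples
   that works at eps0 therefore loses at most n (eps - eps0) <= n eps0^2 / 10
   per error at eps.  If n <= 1 / eps0^2 the resulting errors are below 1/4, and
   averaging the test over a constant number of blocks repairs them.  If
   n > 1 / eps0^2, counting the samples that fall in the Scheffe set {p < q}
   already works with O(n) samples, by Chebyshev, as dTV p q >= 4 eps0. *)
Require Import Defs.
From HB Require Import structures.
From mathcomp Require Import all_boot all_order all_algebra.
From mathcomp Require Import all_classical all_reals ereal.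
From mathcomp Require Import ring lra.
Set Implicit Arguments.
Unset Strict Implicit.
Unset Printing Implicit Defensive.
Import Order.TTheory GRing.Theory Num.Theory.
Local Open Scope classical_set_scope.
Local Open Scope ring_scope.

(** * Weighted sums, product laws and threshold tests *)

Definition expectation {R : realType} {Y : finType} (w f : Y -> R) : R :=
  \sum_y w y * f y.

Definition iid {R : realType} {Y : finType} (k : nat) (w : Y -> R)
    (s : {ffun 'I_k -> Y}) : R :=
  \prod_(i < k) w (s i).

Arguments iid {R Y} k w s.

(** The statistic [f] is left general: it is later the indicator of the Scheffe set on single
    samples, and the acceptance probability of a given test on blocks of samples. *)
Definition counting_test {R : realType} {Y : finType} (f : Y -> R) (mu : R)
    (k : nat) : rtest R Y k :=
  fun s b => (b == (k%:R * mu <= \sum_i f (s i)))%:R.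
Arguments counting_test {R Y} f mu k s b.

Section Expectation.
Variables (R : realType) (Y : finType).
Implicit Types (w f g : Y -> R).

Lemma expectation_ge0 w f :
  (forall y, 0 <= w y) -> (forall y, 0 <= f y) -> 0 <= expectation w f.
Proof. by move=> w0 f0; apply: sumr_ge0 => y _; apply: mulr_ge0. Qed.

Lemma expectation_cst w a :
  distributions R Y w -> expectation w (fun=> a) = a.
Proof. by move=> [_ w1]; rewrite /expectation -mulr_suml w1 mul1r. Qed.

Lemma le_expectation w f g : (forall y, 0 <= w y) ->
  (forall y, f y <= g y) -> expectation w f <= expectation w g.
Proof. by move=> w0 fg; apply: ler_sum => y _; apply: ler_wpM2l. Qed.

Lemma expectationB w f g :
  expectation w (fun y => f y - g y) = expectation w f - expectation w g.
Proof. by rewrite /expectation -sumrB; apply: eq_bigr => y _; rewrite mulrBr. Qed.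

End Expectation.

(** * Second moments of i.i.d. sums and Chebyshev's inequality *)

Section IidSamples.
Variables (R : realType) (Y : finType).
Implicit Types (w f g P Q : Y -> R).

Lemma sum_iid k w : \sum_s iid k w s = (\sum_y w y) ^+ k.
Proof.
by rewrite /iid -(bigA_distr_bigA (fun _ y => w y)) prodr_const card_ord.
Qed.

Lemma iid_ge0 k w s : (forall y, 0 <= w y) -> 0 <= iid k w s.
Proof. by move=> w0; apply: prodr_ge0. Qed.

Lemma distributions_iid k w :
  distributions R Y w -> distributions R _ (iid k w).
Proof.
move=> [w0 w1]; split => [s|]; first exact: iid_ge0.
by rewrite sum_iid w1 expr1n.
Qed.

Lemma expectation_iid_cross k w g (i j : 'I_k) : i != j ->
  expectation w g = 0 ->
  expectation (iid k w) (fun s => g (s i) * g (s j)) = 0.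
Proof.
move=> ij wg0.
(* Absorbing [g] into the weights at [i] and [j] makes the summand a product over coordinates; the
   sum then factorises, and its factor at [i] is the mean of [g]. *)
pose G l y := w y * (if (l == i) || (l == j) then g y else 1).
transitivity (\sum_(s : {ffun 'I_k -> Y}) \prod_l G l (s l)).
  apply: eq_bigr => s _; rewrite /iid big_split /=; congr (_ * _).
  rewrite (bigD1 i) //= eqxx (bigD1 j) 1?eq_sym //= eqxx orbT.
  rewrite big1 ?mulr1 // => l /andP[/negbTE -> /negbTE ->] //.
rewrite -(bigA_distr_bigA G) (bigD1 i) //= /G eqxx /=.
by rewrite [X in X * _](_ : _ = 0) ?mul0r.
Qed.

Lemma variance_iid_le k w g : distributions R Y w ->
  expectation w g = 0 -> (forall y, g y ^+ 2 <= 1) ->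
  expectation (iid k w) (fun s => (\sum_i g (s i)) ^+ 2) <= k%:R.
Proof.
move=> dw wg0 g1.
have -> : expectation (iid k w) (fun s => (\sum_i g (s i)) ^+ 2) =
    \sum_(i < k) \sum_(j < k)
      expectation (iid k w) (fun s => g (s i) * g (s j)).
  rewrite /expectation.
  under eq_bigr => s _.
    rewrite expr2 mulr_suml mulr_sumr.
    under eq_bigr => i _ do rewrite mulr_sumr mulr_sumr.
    over.
  rewrite exchange_big /=; apply: eq_bigr => i _; exact: exchange_big.
have -> : k%:R = \sum_(i < k) (1 : R) by rewrite sumr_const card_ord.
apply: ler_sum => i _; rewrite (bigD1 i) //= big1 ?addr0.
  rewrite -[leRHS](@expectation_cst _ _ (iid k w) 1); last exact: distributions_iid.
  apply: le_expectation => s; last by rewrite -expr2.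
  by apply: iid_ge0; case: dw.
by move=> j ji; apply: expectation_iid_cross; rewrite // eq_sym.
Qed.

(** Markov's inequality for the squared centred sum, whose mean is at most [k], gives the bound 1 /
    (k gamma^2). The event [b] is arbitrary so that both kinds of error are covered. *)
Lemma chebyshev_iid k w f (gamma : R) (b : {ffun 'I_k -> Y} -> bool) :
  distributions R Y w -> (forall y, 0 <= f y <= 1) ->
  0 <= gamma -> 20 <= k%:R * gamma ^+ 2 ->
  (forall s, b s ->
    k%:R * gamma <= `|\sum_i f (s i) - k%:R * expectation w f|) ->
  expectation (iid k w) (fun s => (b s)%:R) <= 20^-1.
Proof.
move=> dw f01 gamma0 kgamma bdev; set m := expectation w f in bdev.
have w0 y : 0 <= w y by case: dw.
have m0 : 0 <= m by apply: expectation_ge0 => // y; case/andP: (f01 y).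
have m1 : m <= 1.
  rewrite -(@expectation_cst _ _ w 1) //.
  by apply: le_expectation => // y; case/andP: (f01 y).
pose g y := f y - m.
have wg0 : expectation w g = 0.
  by rewrite expectationB expectation_cst // subrr.
have g1 y : g y ^+ 2 <= 1.
  by rewrite /g; case/andP: (f01 y) => f0 f1; nra.
have var := variance_iid_le k dw wg0 g1.
set E := expectation _ _.
have E0 : 0 <= E.
  by apply: expectation_ge0 => s; [exact: iid_ge0 | exact: ler0n].
have markov : (k%:R * gamma) ^+ 2 * E <= k%:R.
  apply: le_trans var; rewrite /E /expectation mulr_sumr.
  apply: ler_sum => s _; rewrite mulrCA ler_wpM2l ?iid_ge0 //.
  case: (boolP (b s)) => [/bdev|_]; last by rewrite mulr0 sqr_ge0.
  rewrite mulr1 /g sumrB sumr_const card_ord -[m *+ k]mulr_natl => h.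
  by rewrite -[leRHS]real_normK ?num_real // lerXn2r // nnegrE ?mulr_ge0.
have k0 : 0 < k%:R :> R.
  by rewrite ltr0n lt0n; apply: contraTN kgamma => /eqP ->; rewrite mul0r -ltNge.
have : k%:R * (20 * E) <= k%:R * 1.
  apply: le_trans (_ : k%:R * (k%:R * gamma ^+ 2 * E) <= _).
    by rewrite ler_pM2l // ler_wpM2r.
  by rewrite mulr1; apply: le_trans markov; rewrite exprMn expr2 !mulrA.
by rewrite ler_pM2l // mulrC -ler_pdivlMr // div1r.
Qed.

Lemma is_rtest_counting f mu k : is_rtest (counting_test f mu k).
Proof.
move=> s; split => [b|]; first by rewrite /counting_test ler0n.
by rewrite big_bool /counting_test; case: (_ <= _) => /=;
  rewrite ?addr0 ?add0r.
Qed.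

Lemma counting_test_false_positive w f (mu gamma : R) k :
  distributions R Y w -> (forall y, 0 <= f y <= 1) ->
  0 <= gamma -> 20 <= k%:R * gamma ^+ 2 ->
  expectation w f <= mu - gamma ->
  prob_output w (counting_test f mu k) true <= 20^-1.
Proof.
move=> dw f01 gamma0 kgamma wf; rewrite /prob_output -/(expectation (iid k w) _).
apply: (chebyshev_iid (f := f) (gamma := gamma)) => // s.
rewrite eq_sym eqb_id => h.
apply: le_trans (ler_norm _); have := ler0n R k; nra.
Qed.

Lemma counting_test_false_negative w f (mu gamma : R) k :
  distributions R Y w -> (forall y, 0 <= f y <= 1) ->
  0 <= gamma -> 20 <= k%:R * gamma ^+ 2 ->
  mu + gamma <= expectation w f ->
  prob_output w (counting_test f mu k) false <= 20^-1.
Proof.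
move=> dw f01 gamma0 kgamma wf; rewrite /prob_output -/(expectation (iid k w) _).
apply: (chebyshev_iid (f := f) (gamma := gamma)) => // s.
rewrite eq_sym eqbF_neg -ltNge => h.
by rewrite distrC; apply: le_trans (ler_norm _); have := ler0n R k; nra.
Qed.

(** * Total variation distance, the Scheffe set and perturbed product laws *)

Lemma expectation_sub_shift P Q f (a : R) :
  distributions R Y P -> distributions R Y Q ->
  expectation P f - expectation Q f = \sum_y (P y - Q y) * (f y - a).
Proof.
move=> [_ P1] [_ Q1]; under [RHS]eq_bigr do rewrite mulrBr mulrBl.
by rewrite !sumrB -mulr_suml sumrB P1 Q1 subrr mul0r subr0.
Qed.

Lemma expectation_sub_le_dTV P Q f :
  distributions R Y P -> distributions R Y Q -> (forall y, 0 <= f y <= 1) ->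
  expectation P f - expectation Q f <= dTV P Q.
Proof.
(* Centring at 1/2 gives |f - 1/2| <= 1/2, which matches the factor 1/2 in [dTV]. *)
move=> dP dQ f01; rewrite (expectation_sub_shift _ 2^-1) // /dTV mulr_sumr; apply: ler_sum => y _.
apply: le_trans (ler_norm _) _; rewrite normrM mulrC ler_wpM2r //.
by rewrite ler_norml; case/andP: (f01 y) => *; apply/andP; split; lra.
Qed.

(** After the shift by 1/2, [f] is half the sign of Q - P wherever the two differ, so each term is
    half of |Q - P|. *)
Lemma scheffe P Q : distributions R Y P -> distributions R Y Q ->
  let f y := (P y < Q y)%R%:R in
  expectation Q f - expectation P f = dTV P Q.
Proof.
move=> dP dQ f; rewrite (expectation_sub_shift _ 2^-1) // /dTV mulr_sumr; apply: eq_bigr => y _; rewrite /f.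
by case: ltP => h /=; [rewrite ltr0_norm | rewrite ger0_norm]; lra.
Qed.

Lemma dTVC P Q : dTV P Q = dTV Q P.
Proof. by rewrite /dTV; under eq_bigr do rewrite distrC. Qed.

Lemma bernoulli_ge (x : R) n : 0 <= x -> x <= 1 -> 1 - n%:R * x <= (1 - x) ^+ n.
Proof.
move=> x0 x1; elim: n => [|n IH]; first by rewrite expr0; lra.
by rewrite exprS -natr1; have := ler0n R n; nra.
Qed.

Lemma rtest_ge0_le1 n (phi : rtest R Y n) s b :
  is_rtest phi -> 0 <= phi s b <= 1.
Proof.
move=> /(_ s)[phi0 <-]; rewrite phi0 /= big_bool.
by case: b; rewrite ?lerDl ?lerDr phi0.
Qed.

(* The pointwise minimum M of P and Q has mass 1 - dTV P Q, so the common part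
   M^n of the product laws has mass at least 1 - n * dTV P Q. *)
Lemma prob_output_perturb n P Q (phi : rtest R Y n) b :
  distributions R Y P -> distributions R Y Q -> is_rtest phi ->
  prob_output P phi b <= prob_output Q phi b + n%:R * dTV P Q.
Proof.
move=> [P0 P1] [Q0 Q1] rphi; pose M y := Num.min (P y) (Q y).
have phi01 s : 0 <= phi s b <= 1 := rtest_ge0_le1 s b rphi.
have M0 y : 0 <= M y by rewrite le_min P0 Q0.
have M1 : \sum_y M y = 1 - dTV P Q.
  have -> : dTV P Q = \sum_y (2^-1 * (P y + Q y) - M y).
    rewrite /dTV mulr_sumr; apply: eq_bigr => y _; rewrite /M.
    by case: leP => h; [rewrite ler0_norm | rewrite gtr0_norm]; lra.
  by rewrite sumrB -mulr_sumr big_split /= P1 Q1; lra.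
have MP s : iid n M s <= iid n P s.
  by apply: ler_prod => i _; rewrite M0 ge_min lexx.
have MQ s : iid n M s <= iid n Q s.
  by apply: ler_prod => i _; rewrite M0 ge_min lexx orbT.
have mass : 1 - n%:R * dTV P Q <= \sum_s iid n M s.
  rewrite sum_iid M1; apply: bernoulli_ge.
    by rewrite mulr_ge0 ?invr_ge0 ?sumr_ge0.
  by rewrite -subr_ge0 -M1 sumr_ge0.
(* Pointwise, (P^n - Q^n) phi <= (P^n - M^n) phi <= P^n - M^n, since M^n lies below both product
   laws and 0 <= phi <= 1. *)
have : prob_output P phi b - prob_output Q phi b <=
    \sum_s (iid n P s - iid n M s).
  rewrite -sumrB; apply: ler_sum => s _; rewrite -/(iid n P s) -/(iid n Q s).
  by have := MP s; have := MQ s; have := phi01 s; nra.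
by rewrite sumrB (sum_iid n P) P1 expr1n; lra.
Qed.

(** * Cutting a sample into blocks *)

Definition blocks k n (s : {ffun 'I_(k * n) -> Y}) :
    {ffun 'I_k -> {ffun 'I_n -> Y}} :=
  [ffun i => [ffun j => s (mxvec_index i j)]].

Lemma blocks_bij k n : bijective (@blocks k n).
Proof.
have [unindex indexK unindexK] := curry_mxvec_bij k n.
have {}indexK z := indexK z isT; have {}unindexK l := unindexK l isT.
exists (fun t : {ffun 'I_k -> {ffun 'I_n -> Y}} =>
  [ffun l => t (unindex l).1 (unindex l).2]).
  move=> s; apply/ffunP => l; rewrite !ffunE.
  by have := unindexK l; case: (unindex l) => i j /= ->.
move=> t; apply/ffunP => i; apply/ffunP => j; rewrite !ffunE.
by have /= -> := indexK (i, j).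
Qed.

Lemma iid_blocks k n w (s : {ffun 'I_(k * n) -> Y}) :
  iid k (iid n w) (blocks s) = iid (k * n) w s.
Proof.
rewrite /iid [RHS](reindex _ (curry_mxvec_bij k n)) /=.
rewrite pair_bigA /=.
by apply: eq_bigr => -[i j] _; rewrite !ffunE.
Qed.

(** Lets a test on [k] draws from the n-fold product law run as a test on [k * n] single samples. *)
Lemma expectation_blocks k n w F :
  expectation (iid (k * n) w) (fun s => F (blocks s)) =
  expectation (iid k (iid n w)) F.
Proof.
rewrite /expectation [RHS](reindex _ (onW_bij _ (blocks_bij k n))) /=.
by apply: eq_bigr => s _; rewrite iid_blocks.
Qed.

End IidSamples.

(** * Geometry of the three uncertainty sets *)

Section Robust.
Variables (R : realType) (X : finType).
Implicit Types (A : contamination) (p q P : X -> R) (eps : R).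

Lemma distributions_convex (l : R) p q :
  distributions R X p -> distributions R X q -> 0 <= l <= 1 ->
  distributions R X (fun x => (1 - l) * p x + l * q x).
Proof.
move=> [p0 p1] [q0 q1] /andP[l0 l1]; split => [x|].
  by rewrite addr_ge0 ?mulr_ge0 ?subr_ge0.
by rewrite big_split /= -!mulr_sumr p1 q1; ring.
Qed.

Lemma dTV_le1 p q : distributions R X p -> distributions R X q -> dTV p q <= 1.
Proof.
move=> [p0 p1] [q0 q1]; rewrite /dTV ler_pdivrMl // mulr1.
apply: le_trans (_ : \sum_x (p x + q x) <= _).
  apply: ler_sum => x _; apply: le_trans (ler_normB _ _) _.
  by rewrite !ger0_norm.
by rewrite big_split /= p1 q1.
Qed.

Lemma dTV_convex (l : R) p q : 0 <= l ->
  dTV (fun x => (1 - l) * p x + l * q x) p = l * dTV q p.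
Proof.
move=> l0; rewrite /dTV [RHS]mulrCA; congr (_ * _); rewrite mulr_sumr.
apply: eq_bigr => x _; rewrite -[in RHS](ger0_norm l0) -normrM.
by congr `|_|; ring.
Qed.

Lemma dTV_convexr (l : R) p q : l <= 1 ->
  dTV q (fun x => (1 - l) * p x + l * q x) = (1 - l) * dTV q p.
Proof.
move=> l1; rewrite /dTV [RHS]mulrCA; congr (_ * _); rewrite mulr_sumr.
have l0 : 0 <= 1 - l by rewrite subr_ge0.
apply: eq_bigr => x _; rewrite -[in RHS](ger0_norm l0) -normrM.
by congr `|_|; ring.
Qed.

(** Puts the three models on a common footing: the perturbation and Scheffe arguments use only the
    total variation ball. *)
Lemma uncertainty_dTV A p eps P : distributions R X p -> 0 <= eps <= 1 ->
  uncertainty A p eps P -> distributions R X P /\ dTV P p <= eps.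
Proof.
move=> dp /andP[eps0 eps1]; case: A => /=.
- move=> [h dh <-]; split; first by apply: distributions_convex; rewrite ?eps0.
  by rewrite dTV_convex // ler_piMr // dTV_le1.
- by [].
- move=> [dP Pp]; split=> //; case: (dP) (dp) => P0 P1 [p0 p1].
  (* |P - p| + (P - p) = 2 (P - p)_+ <= 2 eps p pointwise *)
  have : \sum_x (`|P x - p x| + (P x - p x)) <= \sum_x 2 * eps * p x.
    apply: ler_sum => x _; have := Pp x; have := mulr_ge0 eps0 (p0 x).
    by case: (ger0P (P x - p x)) => *; lra.
  by rewrite big_split /= -mulr_sumr sumrB P1 p1 /dTV; lra.
Qed.

Lemma uncertainty_center A p eps : distributions R X p -> 0 <= eps ->
  uncertainty A p eps p.
Proof.
move=> dp eps0; case: (dp) => p0 _; case: A => /=.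
- by exists p => //; apply: funext => x; ring.
- by split=> //; rewrite /dTV big1 ?mulr0 // => x _; rewrite subrr normr0.
- by split=> // x; rewrite ler_peMl // lerDl.
Qed.

Lemma le_uncertainty A p (l eps : R) P : distributions R X p ->
  0 <= l <= 1 -> 0 <= eps ->
  uncertainty A p (l * eps) P -> uncertainty A p eps P.
Proof.
move=> dp /andP[l0 l1] eps0; have le_eps : l * eps <= eps by exact: ler_piMl.
case: A => /=.
(* The surplus contamination mass is spent on [p] itself. *)
- move=> [h dh <-]; exists (fun x => (1 - l) * p x + l * h x).
    by apply: distributions_convex; rewrite ?l0.
  by apply: funext => x; ring.
- by move=> [dP /le_trans]; split; auto.
- move=> [dP Pp]; split=> // x; apply: le_trans (Pp x) _.
  by case: dp => p0 _; rewrite ler_wpM2r // lerD2l.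
Qed.

(** Mixing with the centre scales the deviation from [p] by [l]; for [Hub] the same noise [h]
    serves. *)
Lemma uncertainty_contract A p (l eps : R) P : distributions R X p ->
  0 <= l <= 1 -> uncertainty A p eps P ->
  uncertainty A p (l * eps) (fun x => (1 - l) * p x + l * P x).
Proof.
move=> dp /andP[l0 l1]; case: A => /=.
- by move=> [h dh <-]; exists h => //; apply: funext => x; ring.
- move=> [dP Pp]; split; first by apply: distributions_convex; rewrite ?l0.
  by rewrite dTV_convex // ler_wpM2l.
- move=> [dP Pp]; split; first by apply: distributions_convex; rewrite ?l0.
  by move=> x; have := Pp x; nra.
Qed.

(** * Constructing robust tests *)

Lemma testable_of_errors A p q eps n (phi : rtest R X n) : is_rtest phi ->
  (forall P, uncertainty A p eps P -> prob_output P phi true <= 20^-1) ->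
  (forall Q, uncertainty A q eps Q -> prob_output Q phi false <= 20^-1) ->
  testable A p q eps n.
Proof.
move=> rphi errp errq; exists phi => //.
(* The budget 1/10 is split evenly, whence the 1/20 in the Chebyshev bounds. *)
have -> : (10^-1)%:E = (20^-1 : R)%:E + (20^-1 : R)%:E :> \bar R.
  by rewrite -EFinD; congr EFin; lra.
by apply: leeD; apply: ge_ereal_sup => _ [P UP <-]; rewrite lee_fin; auto.
Qed.

Lemma testable_errors A p q eps n : testable A p q eps n ->
  exists2 phi : rtest R X n, is_rtest phi &
    forall P Q, uncertainty A p eps P -> uncertainty A q eps Q ->
      prob_output P phi true + prob_output Q phi false <= 10^-1.
Proof.
move=> [phi rphi err]; exists phi => // P Q UP UQ.
rewrite -lee_fin; apply: le_trans err; rewrite EFinD.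
by apply: leeD; apply: ereal_sup_ubound; [exists P | exists Q].
Qed.

Lemma le_testable A p q (l eps : R) n :
  distributions R X p -> distributions R X q -> 0 <= l <= 1 -> 0 <= eps ->
  testable A p q eps n -> testable A p q (l * eps) n.
Proof.
move=> dp dq l01 eps0 [phi rphi err]; exists phi => //.
apply: le_trans err; apply: leeD; apply: le_ereal_sup => _ [P UP <-];
  by exists P => //; exact: le_uncertainty l01 eps0 UP.
Qed.

(** Averages over 320 blocks the probability that [phi] outputs [true], and compares it with 1/2.
    Using this probability instead of a random output bit keeps the statistic a function of the
    sample with values in [0, 1]. *)
Lemma testable_amplify A p q eps n (phi : rtest R X n) :
  (forall P, uncertainty A p eps P -> distributions R X P) ->
  (forall Q, uncertainty A q eps Q -> distributions R X Q) ->
  is_rtest phi ->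
  (forall P, uncertainty A p eps P -> prob_output P phi true <= 4^-1) ->
  (forall Q, uncertainty A q eps Q -> prob_output Q phi false <= 4^-1) ->
  testable A p q eps (320 * n).
Proof.
move=> Up Uq rphi errp errq.
pose f s := phi s true; pose psi := counting_test f 2^-1 320%N.
have f01 s : 0 <= f s <= 1 by exact: rtest_ge0_le1.
have phi_split Q : distributions R X Q ->
    prob_output Q phi true + prob_output Q phi false = 1.
  move=> dQ; rewrite -[RHS](@expectation_cst _ _ (iid n Q) 1).
    rewrite /prob_output -big_split; apply: eq_bigr => s _ /=.
    by rewrite -mulrDr; congr (_ * _); have [_] := rphi s; rewrite big_bool.
  exact: distributions_iid.
have out P b : prob_output P (fun s => psi (blocks s)) b =
    prob_output (iid n P) psi b.
  exact: (expectation_blocks P (fun t => psi t b)).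
have g0 : (0 : R) <= 4^-1 by lra.
(* The means are at most 1/4 or at least 3/4, at distance 1/4 from the threshold; 320 is the least
   block count meeting the Chebyshev condition. *)
have g1 : (20 : R) <= 320 * 4^-1 ^+ 2 by rewrite expr2; lra.
apply: (@testable_of_errors _ _ _ _ _ (fun s => psi (blocks s))).
- by move=> s; apply: is_rtest_counting.
- move=> P UP; rewrite out.
  apply: counting_test_false_positive g0 g1 _ => //.
    exact/distributions_iid/Up.
  by have := errp P UP; rewrite /prob_output /expectation; lra.
- move=> Q UQ; rewrite out; have dQ := Uq Q UQ.
  apply: counting_test_false_negative g0 g1 _ => //.
    exact: distributions_iid.
  have := errq Q UQ; have := phi_split Q dQ.
  by rewrite /prob_output /expectation; lra.
Qed.

Lemma testable_scheffe A p q (gamma eps : R) k :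
  distributions R X p -> distributions R X q -> 0 <= eps <= 1 ->
  0 <= gamma -> 20 <= k%:R * gamma ^+ 2 ->
  2 * (eps + gamma) <= dTV p q ->
  testable A p q eps k.
Proof.
move=> dp dq eps01 gamma0 kgamma sep.
pose f x : R := (p x < q x)%R%:R.
have f01 x : 0 <= f x <= 1 by rewrite /f; case: (_ < _); rewrite /= ?lexx ler01.
have pq : expectation q f - expectation p f = dTV p q := scheffe dp dq.
(* The threshold is midway between the two means; contamination shifts each mean by at most [eps],
   leaving a margin of at least [gamma]. *)
pose mu := expectation p f + dTV p q / 2.
apply: (@testable_of_errors _ _ _ _ _ (counting_test f mu k)).
- exact: is_rtest_counting.
- move=> P /(uncertainty_dTV dp eps01)[dP Pp].
  apply: counting_test_false_positive gamma0 kgamma _ => //.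
  by have := expectation_sub_le_dTV dP dp f01; rewrite /mu; lra.
- move=> Q /(uncertainty_dTV dq eps01)[dQ Qq].
  apply: counting_test_false_negative gamma0 kgamma _ => //.
  have := expectation_sub_le_dTV dq dQ f01; rewrite dTVC /mu; lra.
Qed.

Lemma testable_transfer A p q (l eps : R) n :
  distributions R X p -> distributions R X q ->
  0 <= l <= 1 -> 0 <= eps <= 1 ->
  l * eps <= dTV p q / 4 -> (1 - l) * eps <= 10^-1 * (l * eps) ^+ 2 ->
  testable A p q (l * eps) n -> testable A p q eps (320 * n).
Proof.
move=> dp dq l01 eps01 sep close test; set eps0 := l * eps in sep close *.
have [/andP[l0 l1] /andP[e0 e1]] := (l01, eps01).
have eps00 : 0 <= eps0 by rewrite mulr_ge0.
have d1 := dTV_le1 dp dq.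
(* Few samples: the old test survives the perturbation. Many samples: the Scheffe test needs no more
   than a constant multiple of [n]. *)
have [small|large] := lerP (n%:R * eps0 ^+ 2) 1.
- have [phi rphi err] := testable_errors test.
  have shift r b P : distributions R X r -> uncertainty A r eps P ->
      prob_output P phi b <=
      prob_output (fun x => (1 - l) * r x + l * P x) phi b + 10^-1.
    move=> dr UP; have [dP Pr] := uncertainty_dTV dr eps01 UP.
    apply: le_trans (prob_output_perturb b dP _ rphi) _.
      exact: distributions_convex dr dP l01.
    rewrite lerD2l dTV_convexr //.
    apply: le_trans (_ : n%:R * (10^-1 * eps0 ^+ 2) <= _).
      rewrite ler_wpM2l //; apply: le_trans close.
      by rewrite ler_wpM2l ?subr_ge0.
    by rewrite mulrCA ler_piMr.
  have err0 r b P : distributions R X r -> uncertainty A r eps0 P ->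
      0 <= prob_output P phi b.
    move=> dr UP.
    have eps01' : 0 <= eps0 <= 1 by apply/andP; split => //; lra.
    have [[P0 _] _] := uncertainty_dTV dr eps01' UP.
    apply: expectation_ge0 => s; first exact: iid_ge0.
    by case/andP: (rtest_ge0_le1 s b rphi).
  apply: (testable_amplify (phi := phi)) => //.
  + by move=> P /(uncertainty_dTV dp eps01)[].
  + by move=> P /(uncertainty_dTV dq eps01)[].
  + move=> P UP; have UP' := uncertainty_contract dp l01 UP.
    (* Only the sum of the two errors is bounded, so the other error, taken at the centre [q], is
       dropped as nonnegative. The total is 1/10 + 1/10 <= 1/4. *)
    have Uq := uncertainty_center A dq eps00.
    have := err _ _ UP' Uq; have := shift _ true _ dp UP.
    by have := err0 _ false _ dq Uq; lra.
  + move=> Q UQ; have UQ' := uncertainty_contract dq l01 UQ.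
    have Up := uncertainty_center A dp eps00.
    have := err _ _ Up UQ'; have := shift _ false _ dq UQ.
    by have := err0 _ true _ dp Up; lra.
(* Here 320 n (eps0 / 2)^2 = 80 n eps0^2 > 20, and eps <= 3 eps0 / 2 gives 2 (eps + gamma) <= 4 eps0
   <= [dTV p q]. *)
- apply: (testable_scheffe A (gamma := eps0 / 2)) => //; first by lra.
    by rewrite natrM expr_div_n [2 ^+ 2]expr2; lra.
  have : eps - eps0 <= eps0 / 2.
    have -> : eps - eps0 = (1 - l) * eps by rewrite /eps0; ring.
    apply: le_trans close _; rewrite expr2; nra.
  lra.
Qed.

(** * Comparing sample complexities *)

Lemma le_sample_complexity A p q eps eps' k :
  (0 < k)%N ->
  (forall n, testable A p q eps n -> testable A p q eps' (k * n)) ->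
  (sample_complexity A p q eps' <= k%:R%:E * sample_complexity A p q eps)%E.
Proof.
move=> k0 H; have kR : 0 < k%:R :> R by rewrite ltr0n.
(* Dividing by [k] turns the claim into a lower bound on an infimum, which also covers the value +oo
   of the empty set. *)
rewrite -lee_pdivrMl //; apply: le_ereal_inf_tmp => _ [n /= tn <-].
rewrite lee_pdivrMl // -EFinM -natrM.
by apply: ereal_inf_lbound; exists (k * n)%N => //; apply: H.
Qed.

End Robust.

Theorem proposition4p5 (R : realType) :
  exists c a b : R, [/\ 0 < c, 0 < a, 0 < b &
    forall (X : finType) (p q : X -> R) (eps0 eps : R),
      distributions R X p -> distributions R X q ->
      0 <= eps0 -> eps0 <= dTV p q / 4 ->
      0 <= eps - eps0 -> eps - eps0 <= c * eps0 ^+ 2 ->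
      forall A : contamination,
        (a%:E * sample_complexity A p q eps <= sample_complexity A p q eps0)%E
        /\
        (sample_complexity A p q eps0 <= b%:E * sample_complexity A p q eps)%E].
Proof.
(* [c] is the loss allowed per error, [a] inverts the blow-up of [testable_transfer], and [b] is 1
   because a test at [eps] also works at the smaller [eps0]. *)
exists 10^-1, 320^-1, 1; split; [lra | lra | exact: ltr01 |].
move=> X p q eps0 eps dp dq eps00 sep close0 close A.
have d1 := dTV_le1 dp dq.
have close2 : eps <= 1 by rewrite expr2 in close; nra.
have eps_ge0 : 0 <= eps by lra.
(* For eps = 0 this gives l = 0, with l * eps = eps0 still true. *)
pose l := eps0 / eps.
have leps : l * eps = eps0.
  rewrite /l; have [e|e] := eqVneq eps 0; last by rewrite divfK.
  by rewrite e mulr0; lra.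
have l01 : 0 <= l <= 1.
  rewrite /l divr_ge0 //=; have [->|e] := eqVneq eps 0.
    by rewrite invr0 mulr0.
  by rewrite ler_pdivrMr ?mul1r ?lt_def ?e // -subr_ge0.
split.
  rewrite lee_pdivrMl; last by lra.
  apply: (le_sample_complexity (k := 320%N)) => // n.
  rewrite -leps; apply: testable_transfer => //; rewrite ?eps_ge0 ?leps //.
  by rewrite mulrBl mul1r leps.
rewrite (_ : 1 = 1%:R) //; apply: (le_sample_complexity (k := 1%N)) => // n.
by rewrite mul1n -leps; apply: le_testable.
Qed.
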